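(* Let $\mathbf P$ be a finite set, let $\{C(p)\}_{p\in\mathbf P}$ and $\{C'(p)\}_{p\in\mathbf P}$ be collections of graded modules, and suppose that for each $p\in\mathbf P$ there is at most one $k(p)$ such that $C_{k(p)}(p)\neq0\neq C'_{k(p)}(p)$. Let $<_k$ be the partial order on $\mathbf P$ defined by $p<_kp'\Leftrightarrow k(p)<k(p')$. Let $\Delta:\bigoplus_{p\in\mathbf P}C(p)\to\bigoplus_{p\in\mathbf P}C(p)$ and $\Delta':\bigoplus_{p\in\mathbf P}C'(p)\to\bigoplus_{p\in\mathbf P}C'(p)$ be connection matrices of graded module braids $\mathcal G$ and $\mathcal G'$ over $<_k$, with graded module braid isomorphisms $\Phi:\mathcal H\Delta\to\mathcal G$ and $\Phi':\mathcal H\Delta'\to\mathcal G'$, and let $\theta:\mathcal G\to\mathcal G'$ be an isomorphism of graded module braids. Then there exists a unique transition matrix $T:\bigoplus_{p\in\mathbf P}C(p)\to\bigoplus_{p\in\mathbf P}C'(p)$ for $\Delta$ and $\Delta'$ which covers $\theta$ (relative to $\Phi$ and $\Phi'$).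
   Context: The condition means that each $C(p)$ (and the isomorphic $C'(p)$) is nonzero in at most one degree $k(p)$; if $C(p)=0$, $k(p)$ is an arbitrary fixed integer. Below, $<$ stands for any partial order, in particular for $<_k$. Intervals. $\mathbf P$ is a finite set with a (strict) partial order $<$. An interval is a subset $\mathbf I\subseteq\mathbf P$ such that $p,q\in\mathbf I$ and $p<r<q$ imply $r\in\mathbf I$; $\mathbf I(<)$ is the set of intervals. An adjacent $n$-tuple of intervals is an ordered collection $(\mathbf I_1,\dots,\mathbf I_n)$ of mutually disjoint nonempty intervals whose union is an interval and such that $\pi\in\mathbf I_j$, $\pi'\in\mathbf I_k$, $j<k$ imply $\pi'\not<\pi$; $\mathbf I_n(<)$ is the set of these. For $(\mathbf I,\mathbf J)\in\mathbf I_2(<)$ write $\mathbf{IJ}=\mathbf I\cup\mathbf J$. Disjoint $\mathbf I,\mathbf J$ are noncomparable if no element of $\mathbf I$ is comparable to an element of $\mathbf J$. Graded module braids. A graded module braid $\mathcal G$ over $<$ consists of a graded module $G(\mathbf I)$ for each $\mathbf I\in\mathbf I(<)$ and, for each $(\mathbf I,\mathbf J)\in\mathbf I_2(<)$, maps $i(\mathbf I,\mathbf{IJ}):G(\mathbf I)\to G(\mathbf{IJ})$ and $p(\mathbf{IJ},\mathbf J):G(\mathbf{IJ})\to G(\mathbf J)$ of degree $0$ and $\partial(\mathbf J,\mathbf I):G(\mathbf J)\to G(\mathbf I)$ lowering degree by $1$, such that $\cdots\to G(\mathbf I)\xrightarrow{i}G(\mathbf{IJ})\xrightarrow{p}G(\mathbf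 J)\xrightarrow{\partial}G(\mathbf I)\to\cdots$ is exact; $p(\mathbf{JI},\mathbf I)\,i(\mathbf I,\mathbf{IJ})=\mathrm{id}$ if $\mathbf I,\mathbf J$ are noncomparable; and for $(\mathbf I,\mathbf J,\mathbf K)\in\mathbf I_3(<)$ the standard braid diagram formed by the four long exact sequences of $(\mathbf I,\mathbf J)$, $(\mathbf J,\mathbf K)$, $(\mathbf I,\mathbf{JK})$, $(\mathbf{IJ},\mathbf K)$ commutes. A map $\theta:\mathcal G\to\mathcal G'$ is a collection of degree-$0$ homomorphisms $\theta(\mathbf I):G(\mathbf I)\to G'(\mathbf I)$ commuting with all $i,p,\partial$; it is an isomorphism if every $\theta(\mathbf I)$ is. Matrices. A map $T:\bigoplus C(p)\to\bigoplus C'(p)$ is a matrix with entries $T(p,q):C(q)\to C'(p)$; $T(\mathbf I)$ is the submatrix with indices in $\mathbf I$. $T$ is $<$-upper triangular if $T(p,q)\neq0$ implies $p=q$ or $p<q$. A $<$-upper triangular boundary map $\Delta$ on $\bigoplus C(p)$ (degree $-1$, $\Delta^2=0$) generates a chain complex braid $\mathcal C\Delta=\{(C(\mathbf I),\Delta(\mathbf I))\}$, $C(\mathbf I)=\bigoplus_{p\in\mathbf I}C(p)$, with the obvious inclusions $i$ and projections $p$; its homology is a graded module braid $\mathcal H\Delta$. $\Delta$ is a connection matrix of $\mathcal G$ if $\mathcal H\Delta$ is isomorphic to $\mathcal G$ and $C(p)\cong G(\{p\})$ for each $p$. Transition matrices. A matrix $T:\bigoplus C(p)\to\bigoplus C'(p)$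 is a ($0$-degree) transition matrix for $\Delta,\Delta'$ covering the isomorphism $\theta:\mathcal G\to\mathcal G'$ relative to $\Phi,\Phi'$ if the collection $\{T(\mathbf I)\}_{\mathbf I\in\mathbf I(<)}$ consists of degree-$0$ chain maps $\mathcal C\Delta(\mathbf I)\to\mathcal C\Delta'(\mathbf I)$ commuting with all $i$ and $p$, and $\Phi'(\mathbf I)\circ T_*(\mathbf I)=\theta(\mathbf I)\circ\Phi(\mathbf I)$ for all $\mathbf I\in\mathbf I(<)$, where $T_*(\mathbf I)$ is the map induced on homology. *)

(* Defs.v *)
From HB Require Import structures.
From mathcomp Require Import all_boot all_order all_algebra.
From mathcomp Require Import boolp.

Set Implicit Arguments.
Unset Strict Implicit.
Unset Printing Implicit Defensive.

Import Order.TTheory GRing.Theory Num.Theory.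
Local Open Scope ring_scope.
Local Open Scope quotient_scope.

Definition dsum (R : pzRingType) (A : finType) (E : A -> lmodType R) : Type :=
  {dffun forall a : A, E a}.

Section DirectSum.
Variables (R : pzRingType) (A : finType) (E : A -> lmodType R).

HB.instance Definition _ := Choice.copy (dsum E) {dffun forall a : A, E a}.

Implicit Types x y : dsum E.

Definition dapp x (a : A) : E a := (x : {dffun forall a : A, E a}) a.

Definition dmk (F : forall a, E a) : dsum E :=
  finfun F : {dffun forall a : A, E a}.

Lemma dmkE F a : dapp (dmk F) a = F a.
Proof. exact: ffunE. Qed.

Lemma dsumP x y : (forall a, dapp x a = dapp y a) <-> x = y.
Proof. exact: ffunP. Qed.

Definition dsum_zero := dmk (fun=> 0).
Definition dsum_opp x := dmk (fun a => - dapp x a).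
Definition dsum_add x y := dmk (fun a => dapp x a + dapp y a).
Definition dsum_scale k x := dmk (fun a => k *: dapp x a).

Fact dsum_addA : associative dsum_add.
Proof. by move=> x y z; apply/dsumP => a; rewrite !dmkE addrA. Qed.
Fact dsum_addC : commutative dsum_add.
Proof. by move=> x y; apply/dsumP => a; rewrite !dmkE addrC. Qed.
Fact dsum_add0 : left_id dsum_zero dsum_add.
Proof. by move=> x; apply/dsumP => a; rewrite !dmkE add0r. Qed.
Fact dsum_addN : left_inverse dsum_zero dsum_opp dsum_add.
Proof. by move=> x; apply/dsumP => a; rewrite !dmkE addNr. Qed.

HB.instance Definition _ := GRing.isZmodule.Build (dsum E)
  dsum_addA dsum_addC dsum_add0 dsum_addN.

Fact dsum_scaleA k l x : dsum_scale k (dsum_scale l x) = dsum_scale (k * l) x.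
Proof. by apply/dsumP => a; rewrite !dmkE scalerA. Qed.
Fact dsum_scale1 : left_id 1 dsum_scale.
Proof. by move=> x; apply/dsumP => a; rewrite !dmkE scale1r. Qed.
Fact dsum_scaleDr : right_distributive dsum_scale +%R.
Proof. by move=> k x y; apply/dsumP => a; rewrite !dmkE scalerDr. Qed.
Fact dsum_scaleDl x : {morph dsum_scale^~ x : k l / k + l}.
Proof. by move=> k l; apply/dsumP => a; rewrite !dmkE scalerDl. Qed.

HB.instance Definition _ := GRing.Zmodule_isLmodule.Build R (dsum E)
  dsum_scaleA dsum_scale1 dsum_scaleDr dsum_scaleDl.

Lemma dsum0E a : dapp 0 a = 0.
Proof. exact: dmkE. Qed.
Lemma dsumDE x y a : dapp (x + y) a = dapp x a + dapp y a.
Proof. exact: dmkE. Qed.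
Lemma dsumZE k x a : dapp (k *: x) a = k *: dapp x a.
Proof. exact: dmkE. Qed.

End DirectSum.

Section QuotientModule.
Variables (R : pzRingType) (V : lmodType R) (S : submodClosed V).

(* [Quotient.quot] expects a zmodClosed predicate, which a submodClosed one  *)
(* does not canonically provide.                                             *)
Definition zsub : {pred V} := fun x => x \in S.

Fact zsub_closed : zmod_closed zsub.
Proof.
split=> [|x y Sx Sy]; first exact: rpred0 S.
by rewrite -scaleN1r; apply: rpredD => //; apply: rpredZ.
Qed.

HB.instance Definition _ := GRing.isZmodClosed.Build V zsub zsub_closed.

Definition lquot := Quotient.quot zsub.

HB.instance Definition _ := GRing.Zmodule.on lquot.
HB.instance Definition _ := ZmodQuotient.on lquot.

Lemma lquotP (x y : V) : \pi_lquot x = \pi_lquot y <-> x - y \in S.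
Proof.
rewrite -[_ \in S]/(x - y \in zsub) (Quotient.idealrBE zsub).
by split=> /eqP.
Qed.

Lemma lquotD (x y : V) : \pi_lquot (x + y) = \pi_lquot x + \pi_lquot y.
Proof. exact: (raddfD \pi_lquot). Qed.

Definition lquot_scale k : lquot -> lquot := lift_op1 lquot ( *:%R k).

Lemma lquot_scale_pi k x : lquot_scale k (\pi_lquot x) = \pi_lquot (k *: x).
Proof.
rewrite /lquot_scale; unlock; apply/lquotP; rewrite -scalerBr rpredZ //.
by apply/lquotP; rewrite reprK.
Qed.

Fact lquot_scaleA k l x :
  lquot_scale k (lquot_scale l x) = lquot_scale (k * l) x.
Proof. by rewrite -[x]reprK !lquot_scale_pi scalerA. Qed.
Fact lquot_scale1 : left_id 1 lquot_scale.
Proof. by move=> x; rewrite -[x]reprK !lquot_scale_pi scale1r. Qed.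
Fact lquot_scaleDr : right_distributive lquot_scale +%R.
Proof.
move=> k x y; rewrite -[x]reprK -[y]reprK -lquotD !lquot_scale_pi.
by rewrite scalerDr lquotD.
Qed.
Fact lquot_scaleDl x : {morph lquot_scale^~ x : k l / k + l}.
Proof. by move=> k l; rewrite -[x]reprK !lquot_scale_pi scalerDl lquotD. Qed.

HB.instance Definition _ := GRing.Zmodule_isLmodule.Build R lquot
  lquot_scaleA lquot_scale1 lquot_scaleDr lquot_scaleDl.

Lemma lquotZ k (x : V) : \pi_lquot (k *: x) = k *: \pi_lquot x.
Proof. by rewrite -lquot_scale_pi. Qed.

End QuotientModule.

Section Homology.
Variables (R : pzRingType) (U V W : lmodType R).
Variables (f : {linear U -> V}) (g : {linear V -> W}).

Definition ker_pred : {pred V} := fun x => g x == 0.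

Fact ker_submod_closed : submod_closed ker_pred.
Proof.
split=> [|k x y]; rewrite !unfold_in ?linear0 // => /eqP gx /eqP gy.
by rewrite linearP gx gy scaler0 addr0.
Qed.

HB.instance Definition _ := GRing.isSubmodClosed.Build R V ker_pred
  (GRing.submod_closed_semi ker_submod_closed).

HB.instance Definition _ := GRing.isZmodClosed.Build V ker_pred
  (GRing.submod_closedB ker_submod_closed).

Definition cycle := {x : V | ker_pred x}.

HB.instance Definition _ := SubChoice.on cycle.
HB.instance Definition _ := [SubChoice_isSubLmodule of cycle by <:].

Lemma cycleE (z : cycle) : g (val z) = 0.
Proof. by apply/eqP; exact: (valP z). Qed.

Definition boundary : {pred cycle} := fun z => `[< exists u, f u = val z >].

Fact boundary_submod_closed : submod_closed boundary.
Proof.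
split=> [|k x y]; first by apply/asboolP; exists 0; rewrite !linear0.
move=> /asboolP[u fu] /asboolP[v fv]; apply/asboolP.
by exists (k *: u + v); rewrite !linearP fu fv.
Qed.

HB.instance Definition _ := GRing.isSubmodClosed.Build R cycle boundary
  (GRing.submod_closed_semi boundary_submod_closed).

Definition homology : lmodType R := lquot boundary.

Definition hclass (z : cycle) : homology := \pi_(lquot boundary) z.

Lemma hclassP z z' : hclass z = hclass z' <-> exists u, f u = val z - val z'.
Proof.
have -> : val z - val z' = val (z - z') by rewrite linearB.
by rewrite lquotP; split=> /asboolP.
Qed.

Lemma hclass_linear : linear hclass.
Proof. by move=> k x y; rewrite /hclass lquotD lquotZ. Qed.

HB.instance Definition _ :=
  GRing.isLinear.Build R cycle homology _ hclass hclass_linear.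

Lemma hclass_surj (h : homology) : exists z, hclass z = h.
Proof. by exists (repr (h : lquot boundary)); rewrite /hclass reprK. Qed.

End Homology.

Section InducedMap.
Variables (R : pzRingType) (U V W U' V' W' : lmodType R).
Variables (f : {linear U -> V}) (g : {linear V -> W}).
Variables (f' : {linear U' -> V'}) (g' : {linear V' -> W'}).
Variable h : {linear V -> V'}.

Definition preserves_cycles := forall x, g x = 0 -> g' (h x) = 0.
Definition preserves_boundaries :=
  forall u, g (f u) = 0 -> exists u', f' u' = h (f u).

Fact cycle_map_subproof (hZ : preserves_cycles) (z : cycle g) :
  ker_pred g' (h (val z)).
Proof. by apply/eqP/hZ; exact: cycleE. Qed.

Definition cycle_map hZ z : cycle g' :=
  Sub (h (val z)) (cycle_map_subproof hZ z).

(* The map [x] |-> [h x] between the homology modules. It is given the junk  *)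
(* value 0 when [h] does not preserve cycles and boundaries.                 *)
Definition induced_fun (c : homology f g) : homology f' g' :=
  match pselect preserves_cycles, pselect preserves_boundaries with
  | left hZ, left _ =>
      hclass f' (cycle_map hZ (repr (c : lquot (boundary f (g := g)))))
  | _, _ => 0
  end.

Lemma induced_funE (hZ : preserves_cycles) (hB : preserves_boundaries) z :
  induced_fun (hclass f z) = hclass f' (cycle_map hZ z).
Proof.
rewrite /induced_fun; case: pselect => // hZ'; case: pselect => // hB'.
apply/hclassP; rewrite /= -linearB.
pose c : lquot (boundary f (g := g)) := hclass f z.
have /hclassP[u fu] : hclass f (repr c) = hclass f z by rewrite /hclass reprK.
rewrite -fu; apply: hB; rewrite fu linearB.
by rewrite !cycleE subrr.
Qed.

Fact induced_fun_linear : linear induced_fun.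
Proof.
have [hZ|nZ] := pselect preserves_cycles; last first.
  move=> k x y; rewrite /induced_fun; case: pselect => // _.
  by rewrite scaler0 addr0.
have [hB|nB] := pselect preserves_boundaries; last first.
  move=> k x y; rewrite /induced_fun; case: pselect => // hZ'.
  by case: pselect => // _; rewrite scaler0 addr0.
move=> k x y; have [a <-] := hclass_surj x; have [b <-] := hclass_surj y.
rewrite -linearP !(induced_funE hZ hB) -linearP; congr hclass.
by apply: val_inj; rewrite !(linearP, SubK) /=.
Qed.

HB.instance Definition _ := GRing.isLinear.Build R
  (homology f g) (homology f' g') _ induced_fun induced_fun_linear.

Definition induced : {linear homology f g -> homology f' g'} := induced_fun.

End InducedMap.

Section Intervals.
Variables (P : finType) (lt : rel P).

Definition interval (I : {set P}) : bool :=
  [forall p in I, forall q in I, forall r, lt p r && lt r q ==> (r \in I)].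

Definition adjacent (s : seq {set P}) : bool :=
  [&& all (fun I : {set P} => interval I && (I != set0)) s,
      pairwise (fun I J : {set P} => [disjoint I & J]
                 && [forall p in I, forall q in J, ~~ lt q p]) s
    & interval (\bigcup_(I <- s) I)].

Definition noncomparable (I J : {set P}) : bool :=
  [disjoint I & J] && [forall p in I, forall q in J, ~~ lt p q && ~~ lt q p].

End Intervals.

(* The structure maps are indexed by their source and target sets, as in     *)
(* i(I, IJ), p(IJ, J), d(J, I). Everything is given for arbitrary subsets of *)
(* [P] so as to avoid dependent indices; only the values at intervals I and  *)
(* at adjacent pairs (I, J), with IJ = I :|: J, are ever referred to.        *)
Record braid_data (R : pzRingType) (P : finType) := BraidData {
  bmod :> {set P} -> int -> lmodType R;
  bi : forall I K n, {linear bmod I n -> bmod K n};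
  bp : forall K J n, {linear bmod K n -> bmod J n};
  bd : forall J I n, {linear bmod J n -> bmod I (n - 1)}
}.

Section Braids.
Variables (R : pzRingType) (P : finType) (lt : rel P).

(* Exactness of the long sequences at their three kinds of terms, splitting, *)
(* and the six cells of the braid diagram of an adjacent triple.             *)
Record graded_module_braid (G : braid_data R P) : Prop := {
  braid_exact_mid : forall I J, adjacent lt [:: I; J] ->
    forall n (x : G (I :|: J) n),
    bp G (I :|: J) J n x = 0 <-> exists y, bi G I (I :|: J) n y = x;
  braid_exact_right : forall I J, adjacent lt [:: I; J] ->
    forall n (x : G J n),
    bd G J I n x = 0 <-> exists y, bp G (I :|: J) J n y = x;
  braid_exact_left : forall I J, adjacent lt [:: I; J] ->
    forall n (x : G I (n - 1)),
    bi G I (I :|: J) (n - 1) x = 0 <-> exists y, bd G J I n y = x;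
  braid_split : forall I J, adjacent lt [:: I; J] -> noncomparable lt I J ->
    forall n (x : G I n), bp G (I :|: J) I n (bi G I (I :|: J) n x) = x;
  braid_ii : forall I J K, adjacent lt [:: I; J; K] -> forall n (x : G I n),
    bi G (I :|: J) (I :|: J :|: K) n (bi G I (I :|: J) n x)
    = bi G I (I :|: J :|: K) n x;
  braid_pp : forall I J K, adjacent lt [:: I; J; K] ->
    forall n (x : G (I :|: J :|: K) n),
    bp G (J :|: K) K n (bp G (I :|: J :|: K) (J :|: K) n x)
    = bp G (I :|: J :|: K) K n x;
  braid_ip : forall I J K, adjacent lt [:: I; J; K] ->
    forall n (x : G (I :|: J) n),
    bp G (I :|: J :|: K) (J :|: K) n (bi G (I :|: J) (I :|: J :|: K) n x)
    = bi G J (J :|: K) n (bp G (I :|: J) J n x);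
  braid_pd : forall I J K, adjacent lt [:: I; J; K] -> forall n (x : G K n),
    bp G (I :|: J) J (n - 1) (bd G K (I :|: J) n x) = bd G K J n x;
  braid_di : forall I J K, adjacent lt [:: I; J; K] -> forall n (x : G J n),
    bd G (J :|: K) I n (bi G J (J :|: K) n x) = bd G J I n x;
  braid_id : forall I J K, adjacent lt [:: I; J; K] ->
    forall n (x : G (J :|: K) n),
    bi G I (I :|: J) (n - 1) (bd G (J :|: K) I n x)
    = bd G K (I :|: J) n (bp G (J :|: K) K n x)
}.

Definition braid_fam (G G' : braid_data R P) :=
  forall I n, {linear G I n -> G' I n}.

Record braid_map (G G' : braid_data R P) (theta : braid_fam G G') : Prop := {
  braid_map_i : forall I J, adjacent lt [:: I; J] -> forall n (x : G I n),
    theta (I :|: J) n (bi G I (I :|: J) n x)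
    = bi G' I (I :|: J) n (theta I n x);
  braid_map_p : forall I J, adjacent lt [:: I; J] ->
    forall n (x : G (I :|: J) n),
    theta J n (bp G (I :|: J) J n x)
    = bp G' (I :|: J) J n (theta (I :|: J) n x);
  braid_map_d : forall I J, adjacent lt [:: I; J] -> forall n (x : G J n),
    theta I (n - 1) (bd G J I n x) = bd G' J I n (theta J n x)
}.

Definition braid_iso (G G' : braid_data R P) (theta : braid_fam G G') : Prop :=
  braid_map theta
  /\ forall I, interval lt I -> forall n, bijective (theta I n).

End Braids.

Section Submatrices.
Variables (R : pzRingType) (P : finType).

Definition isum (E : P -> lmodType R) (I : {set P}) : lmodType R :=
  dsum (fun p : {p : P | p \in I} => E (val p)).

Section Transfer.
Variables (E : P -> lmodType R) (I K : {set P}).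

(* Keep the summands common to [I] and [K] and put 0 in the others: this is  *)
(* the inclusion of C(I) in C(K) if I is a subset of K, and the projection   *)
(* of C(I) onto C(K) if K is a subset of I.                                  *)
Definition transfer_fun (x : isum E I) : isum E K :=
  dmk (fun p : {p : P | p \in K} =>
    match @idP (val p \in I) return E (val p) with
    | ReflectT pI => dapp x (exist _ (val p) pI)
    | ReflectF _ => 0
    end).

Fact transfer_fun_linear : linear transfer_fun.
Proof.
move=> k x y; apply/dsumP => a; rewrite dsumDE dsumZE !dmkE.
by case: {-}_ / idP => h; rewrite ?dsumDE ?dsumZE ?scaler0 ?addr0.
Qed.

HB.instance Definition _ := GRing.isLinear.Build R (isum E I) (isum E K) _
  transfer_fun transfer_fun_linear.

Definition transfer : {linear isum E I -> isum E K} := transfer_fun.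

End Transfer.

Section Submatrix.
Variables (E F : P -> lmodType R) (M : forall p q, {linear E q -> F p}).
Variables I J : {set P}.

Definition submatrix_fun (x : isum E J) : isum F I :=
  dmk (fun p : {p : P | p \in I} =>
    \sum_(q : {q : P | q \in J}) M (val p) (val q) (dapp x q)).

Fact submatrix_fun_linear : linear submatrix_fun.
Proof.
move=> k x y; apply/dsumP => a; rewrite dsumDE dsumZE !dmkE.
rewrite scaler_sumr -big_split /=; apply: eq_bigr => b _.
by rewrite dsumDE dsumZE linearP.
Qed.

HB.instance Definition _ := GRing.isLinear.Build R (isum E J) (isum F I) _
  submatrix_fun submatrix_fun_linear.

Definition submatrix : {linear isum E J -> isum F I} := submatrix_fun.

End Submatrix.

(* Matrices of maps between graded modules; the entry at (p, q) is given by  *)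
(* its components from degree m to degree n.                                 *)
Definition gmatrix (C D : P -> int -> lmodType R) :=
  forall p q m n, {linear C q m -> D p n}.

Definition homogeneous (C D : P -> int -> lmodType R) (d : int)
    (M : gmatrix C D) : Prop :=
  forall p q m n x, M p q m n x != 0 -> n = m + d.

Definition upper_triangular (lt : rel P) (C D : P -> int -> lmodType R)
    (M : gmatrix C D) : Prop :=
  forall p q m n x, M p q m n x != 0 -> p = q \/ lt p q.

(* The block M(I, J) : C(J) -> D(I), from degree m to degree n.              *)
Definition gblock (C D : P -> int -> lmodType R) (M : gmatrix C D)
    (I J : {set P}) (m n : int) :
    {linear isum (C^~ m) J -> isum (D^~ n) I} :=
  submatrix (fun p q => M p q m n) I J.

Definition boundary_matrix (C : P -> int -> lmodType R) (Delta : gmatrix C C) :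
    Prop :=
  homogeneous (-1) Delta
  /\ forall l m n x, gblock Delta [set: P] [set: P] m n
                       (gblock Delta [set: P] [set: P] l m x) = 0.

End Submatrices.

Section ConnectionMatrices.
Variables (R : pzRingType) (P : finType).

(* The connecting homomorphism of 0 -> C(I) -> C(IJ) -> C(J) -> 0 lifts a    *)
(* cycle of C(J) to C(IJ) by zero and applies Delta(IJ), which leaves the    *)
(* component in C(I), so it is induced by the block Delta(I, J).             *)
Definition homology_braid (C : P -> int -> lmodType R) (Delta : gmatrix C C) :
    braid_data R P :=
  @BraidData R P
    (fun I n =>
       homology (gblock Delta I I (n + 1) n) (gblock Delta I I n (n - 1)))
    (fun I K n => induced _ _ _ _ (transfer (C^~ n) I K))
    (fun K J n => induced _ _ _ _ (transfer (C^~ n) K J))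
    (fun J I n => induced _ _ _ _ (gblock Delta I J n (n - 1))).

Definition homology_map (C C' : P -> int -> lmodType R)
    (Delta : gmatrix C C) (Delta' : gmatrix C' C') (T : gmatrix C C') :
    braid_fam (homology_braid Delta) (homology_braid Delta') :=
  fun I n => induced _ _ _ _ (gblock T I I n n).

Arguments homology_map {C C'} Delta Delta' T I n.

Variable lt : rel P.

Definition connection_matrix (C : P -> int -> lmodType R)
    (Delta : gmatrix C C) (G : braid_data R P) : Prop :=
  [/\ boundary_matrix Delta,
      upper_triangular lt Delta,
      exists Phi : braid_fam (homology_braid Delta) G, braid_iso lt Phi
    & forall p n, exists phi : {linear C p n -> G [set p] n}, bijective phi].

Record transition_matrix (C C' : P -> int -> lmodType R)
    (Delta : gmatrix C C) (Delta' : gmatrix C' C') (G G' : braid_data R P)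
    (Phi : braid_fam (homology_braid Delta) G)
    (Phi' : braid_fam (homology_braid Delta') G')
    (theta : braid_fam G G') (T : gmatrix C C') : Prop := {
  transition_degree : homogeneous 0 T;
  transition_chain : forall I, interval lt I -> forall m n x,
    gblock Delta' I I m n (gblock T I I m m x)
    = gblock T I I n n (gblock Delta I I m n x);
  transition_i : forall I J, adjacent lt [:: I; J] -> forall n x,
    gblock T (I :|: J) (I :|: J) n n (transfer (C^~ n) I (I :|: J) x)
    = transfer (C'^~ n) I (I :|: J) (gblock T I I n n x);
  transition_p : forall I J, adjacent lt [:: I; J] -> forall n x,
    gblock T J J n n (transfer (C^~ n) (I :|: J) J x)
    = transfer (C'^~ n) (I :|: J) J (gblock T (I :|: J) (I :|: J) n n x);
  transition_covers : forall I, interval lt I -> forall n c,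
    Phi' I n (homology_map Delta Delta' T I n c) = theta I n (Phi I n c)
}.

End ConnectionMatrices.

Definition degree_order (P : finType) (k : P -> int) : rel P :=
  fun p q => k p < k q.

(* Main.v *)
(* In degree n the homology of {p} is C(p)_n, and an isomorphism between the  *)
(* homology braids forces T to be diagonal, T(p,p) being its component at    *)
(* {p}: for p <> q with k p = k q, both ({p},{q}) and ({q},{p}) are adjacent,*)
(* so T commutes with the inclusions of either in {p,q}. Delta(p,q) can only *)
(* be nonzero if k p = k q - 1; then {p,q} is an interval and Delta(p,q) is  *)
(* the connecting map, so compatibility with it makes T a chain map. Finally *)
(* T induces the given map on H_n(I): H_n of the part of I of degree <= n    *)
(* surjects onto H_n(I), and is detected by projecting to the {p}, k p = n.  *)

Require Import Defs.
From HB Require Import structures.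
From mathcomp Require Import all_boot all_order all_algebra.
From mathcomp Require Import boolp zify.

Set Implicit Arguments.
Unset Strict Implicit.
Unset Printing Implicit Defensive.
Import Order.TTheory GRing.Theory Num.Theory Defs.
Local Open Scope ring_scope.

(** Elements of equal degree are incomparable, and this forces a transition matrix to be diagonal.
    Let [psi] be the inverse of [Phi'] composed with [theta] and [Phi], a map between the two
    homology braids ([braid_map_lift]). No differential acts inside a single C(p), so H({p}) is
    C(p), and [psi] at {p} is a linear map t(p) from C(p) to C'(p) ([homology_set1],
    [braid_map_diagonal]). The matrix sought is the diagonal matrix of the t(p).

    It is a chain map because a nonzero Delta(p,q) joins consecutive degrees and is then the
    connecting map of ({p},{q}), with which [psi] commutes ([diagonal_commutes]). It induces [psi]
    on H_n(I): in an interval of degrees at most n a cycle of degree n is determined by its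
    projections to the {p} with k p = n ([braid_map_class_top]), and every class of H_n(I) comes
    from the part of I of degree at most n ([braid_map_class]).

    For uniqueness, covering [theta] at {p} fixes the diagonal entries. An entry at p <> q vanishes
    for reasons of degree unless k p = k q, and in that case because the matrix commutes with the
    inclusion of {q} in {q,p}. *)

Lemma linear_lift (R : pzRingType) (U V W : lmodType R)
    (f : {linear V -> W}) (g : {linear U -> W}) :
  bijective f -> exists h : {linear U -> V}, forall x, f (h x) = g x.
Proof.
case=> f' fK f'K.
pose fI := GRing.isLinear.Build R W V _ f' (can2_linear fK f'K).
pose F' : {linear W -> V} := HB.pack f' fI.
by exists (F' \o g) => x; rewrite /= f'K.
Qed.

Lemma inj_surj_bij (A B : Type) (f : A -> B) :
  injective f -> (forall y, exists x, f x = y) -> bijective f.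
Proof.
move=> fI fS; exists (fun y => sval (cid (fS y))) => [x|y].
  by apply: fI; case: cid.
by case: cid.
Qed.

(** * Coordinates and submatrices *)

Section Coordinates.
Variables (R : pzRingType) (P : finType).
Implicit Types (E F : P -> lmodType R) (I J K : {set P}).

(* The coordinates of x are indexed by all of P, those outside I being 0, so *)
(* that no membership proofs occur in indices.                               *)
Definition coord E I (x : isum E I) (p : P) : E p :=
  match @idP (p \in I) with
  | ReflectT pI => dapp x (exist _ p pI)
  | ReflectF _ => 0
  end.

Lemma coord_val E I (x : isum E I) a : coord x (val a) = dapp x a.
Proof.
case: a => p pI; rewrite /coord /=; case: {-}_ / idP => [h|/(_ pI)//].
by rewrite (bool_irrelevance h pI).
Qed.

Lemma coord_mk E I (f : forall p, E p) p :
  coord (dmk (fun a : {p | p \in I} => f (val a)) : isum E I) p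
  = if p \in I then f p else 0.
Proof.
rewrite /coord; case: {-}_ / idP => h.
  by rewrite dmkE h.
by case: ifP => // /h.
Qed.

Lemma coord_out E I (x : isum E I) p : p \notin I -> coord x p = 0.
Proof. by rewrite /coord; case: {-}_ / idP => // h /negP[]. Qed.

Lemma coord_ext E I (x y : isum E I) :
  (forall p, p \in I -> coord x p = coord y p) -> x = y.
Proof.
by move=> xy; apply/dsumP => a; rewrite -!coord_val; apply: xy; exact: valP.
Qed.

Lemma coord_linear E I p : linear (fun x : isum E I => coord x p).
Proof.
move=> k x y; rewrite /coord; case: {-}_ / idP => h.
  by rewrite dsumDE dsumZE.
by rewrite scaler0 addr0.
Qed.

Lemma coord0 E I p : coord (0 : isum E I) p = 0.
Proof. by rewrite /coord; case: {-}_ / idP => // h; rewrite dsum0E. Qed.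

Lemma coord_transfer E I K (x : isum E I) p :
  coord (transfer E I K x) p = if p \in K then coord x p else 0.
Proof. exact: (coord_mk K (coord x)). Qed.

Lemma coord_submatrix E F (M : forall p q, {linear E q -> F p}) I J x p :
  coord (submatrix M I J x) p
  = if p \in I then \sum_(q in J) M p q (coord x q) else 0.
Proof.
rewrite -(coord_mk I (fun p => \sum_(q in J) M p q (coord x q))).
congr (coord _ p); apply/dsumP => a; rewrite !dmkE [RHS]big_sub.
by apply: eq_bigr => b _; rewrite coord_val.
Qed.

Lemma isum_single E I p (u : E p) :
  p \in I -> exists x : isum E I,
    coord x p = u /\ forall q, q != p -> coord x q = 0.
Proof.
move=> pI; pose f := dfwith (fun q => 0 : E q) u.
exists (dmk (fun a : {p | p \in I} => f (val a)) : isum E I).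
have fE := coord_mk I f; split=> [|q qp]; rewrite fE.
  by rewrite pI; exact: dfwith_in.
case: ifP => // _; apply: (dfwith_out (fun q => 0 : E q)).
by rewrite eq_sym.
Qed.

(** Both sides reduce to sums over the common part of [I] and [K]. For [I] inside [K] the hypothesis
    excludes entries from [I] to the rest of [K] (inclusions); for [K] inside [I] it excludes
    entries from the rest of [I] to [K] (projections). *)
Lemma submatrix_transfer E F (M : forall p q, {linear E q -> F p}) I K :
  (forall p q x, p \in K -> q \in I -> M p q x != 0 -> p \in I /\ q \in K) ->
  forall x, submatrix M K K (transfer E I K x)
            = transfer F I K (submatrix M I I x).
Proof.
move=> MIK x; apply: coord_ext => p pK.
rewrite coord_submatrix coord_transfer pK coord_submatrix.
transitivity (\sum_(q in I) M p q (coord (transfer E I K x) q)).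
  rewrite big_mkcond [RHS]big_mkcond; apply: eq_bigr => q _.
  rewrite coord_transfer.
  have [qK|qK] := boolP (q \in K); last by rewrite linear0 if_same.
  by case: ifP => // /negbT qI; rewrite coord_out ?linear0.
have [pI|pI] := boolP (p \in I).
  apply: eq_bigr => q qI; rewrite coord_transfer.
  case: (boolP (q \in K)) => // qK; rewrite linear0; apply/esym/eqP.
  by apply: contraNT qK => /(MIK _ _ _ pK qI)[].
apply: big1 => q qI; apply/eqP.
by apply: contraNT pI => /(MIK _ _ _ pK qI)[].
Qed.

End Coordinates.

(** * Maps induced on homology *)

Lemma induced_hclass (R : pzRingType) (U V W U' V' W' : lmodType R)
    (f : {linear U -> V}) (g : {linear V -> W})
    (f' : {linear U' -> V'}) (g' : {linear V' -> W'}) (h : {linear V -> V'}) :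
  preserves_cycles g g' h -> preserves_boundaries f g f' h ->
  forall (z : cycle g) (z' : cycle g'), val z' = h (val z) ->
  induced f g f' g' h (hclass f z) = hclass f' z'.
Proof.
move=> hZ hB z z' zz'; rewrite [LHS](induced_funE hZ hB); congr hclass.
by apply: val_inj; rewrite zz'.
Qed.

(** A chain map meets both conditions that guard the default value of [induced]. Any cycle [z'] with
    the right underlying vector is accepted, so no membership proofs have to match. *)
Lemma induced_chain (R : pzRingType) (U V W U' V' W' : lmodType R)
    (f : {linear U -> V}) (g : {linear V -> W})
    (f' : {linear U' -> V'}) (g' : {linear V' -> W'}) (hU : U -> U')
    (h : {linear V -> V'}) (hW : {linear W -> W'}) :
  (forall u, f' (hU u) = h (f u)) -> (forall v, g' (h v) = hW (g v)) ->
  forall (z : cycle g) (z' : cycle g'), val z' = h (val z) ->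
  induced f g f' g' h (hclass f z) = hclass f' z'.
Proof.
move=> fh gh; apply: induced_hclass => [x gx|u _].
  by rewrite gh gx linear0.
by exists (hU u).
Qed.

(** * Intervals and adjacent pairs for the degree order *)

Section Intervals.
Variables (P : finType) (lt : rel P).
Implicit Types I J : {set P}.

Lemma adjacent_pair I J :
  adjacent lt [:: I; J] <->
  [/\ interval lt I /\ I != set0, interval lt J /\ J != set0, [disjoint I & J],
      forall p q, p \in I -> q \in J -> ~~ lt q p & interval lt (I :|: J)].
Proof.
rewrite /adjacent /= !andbT 2!big_cons big_nil setU0; split.
  case/and3P=> /andP[/andP[-> ->] /andP[-> ->]] /andP[-> /forall_inP ltIJ] ->.
  by split=> // p q pI qJ; move/forall_inP: (ltIJ p pI); apply.
case=> -[-> ->] [-> ->] -> ltIJ -> /=; rewrite andbT.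
by apply/forall_inP => p pI; apply/forall_inP => q; apply: ltIJ.
Qed.

End Intervals.

Section DegreeOrder.
Variables (P : finType) (k : P -> int).
Implicit Types I J : {set P}.

Lemma interval_degreeP I :
  interval (degree_order k) I <->
  forall p q r, p \in I -> q \in I -> k p < k r -> k r < k q -> r \in I.
Proof.
split=> [/forall_inP HI p q r pI qI pr rq|HI].
  move/forall_inP: (HI p pI) => /(_ q qI) /forallP /(_ r) /implyP; apply.
  by rewrite /degree_order pr.
apply/forall_inP => p pI; apply/forall_inP => q qI; apply/forallP => r.
by apply/implyP => /andP[pr rq]; exact: HI pr rq.
Qed.

Lemma interval_set1 p : interval (degree_order k) [set p].
Proof.
apply/interval_degreeP => a b r; rewrite !inE => /eqP-> /eqP-> pr rp.
by have := lt_trans pr rp; rewrite ltxx.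
Qed.

(** No integer lies strictly between [k p] and [k q]. Consecutive degrees give the connecting maps,
    equal degrees the vanishing of off-diagonal entries. *)
Lemma adjacent_set1 p q :
  p != q -> k p <= k q <= k p + 1 ->
  adjacent (degree_order k) [:: [set p]; [set q]].
Proof.
move=> pq /andP[kpq kqp]; apply/adjacent_pair; split.
- by split; [exact: interval_set1 | apply/set0Pn; exists p; rewrite inE].
- by split; [exact: interval_set1 | apply/set0Pn; exists q; rewrite inE].
- by rewrite disjoints1 inE.
- by move=> a b; rewrite !inE => /eqP-> /eqP->; rewrite /degree_order -leNgt.
apply/interval_degreeP => a b r.
by rewrite !inE => /orP[] /eqP-> /orP[] /eqP->; lia.
Qed.

Lemma adjacent_degree_cut I n :
  interval (degree_order k) I ->
  [set p in I | k p <= n] != set0 -> [set p in I | n < k p] != set0 ->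
  adjacent (degree_order k)
    [:: [set p in I | k p <= n]; [set p in I | n < k p]].
Proof.
move=> /interval_degreeP HI A0 B0; apply/adjacent_pair; split.
- split=> //; apply/interval_degreeP => p q r; rewrite !inE.
  move=> /andP[pI pn] /andP[qI qn] pr rq; apply/andP; split; last by lia.
  exact: HI pr rq.
- split=> //; apply/interval_degreeP => p q r; rewrite !inE.
  move=> /andP[pI pn] /andP[qI qn] pr rq; apply/andP; split; last by lia.
  exact: HI pr rq.
- rewrite -setI_eq0; apply/eqP/setP => p; rewrite !inE.
  by case: (p \in I) => //=; lia.
- by move=> p q; rewrite !inE /degree_order; lia.
apply/interval_degreeP => p q r; rewrite !inE => pI qI pr rq.
suff -> : r \in I by lia.
by apply: (HI p q r) => //; lia.
Qed.

(** An element of maximal degree is below nothing in [I], even when others share its degree, so it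
    can always be split off as the last piece. *)
Lemma adjacent_degree_top I p :
  interval (degree_order k) I -> p \in I -> I :\ p != set0 ->
  (forall q, q \in I -> k q <= k p) ->
  adjacent (degree_order k) [:: I :\ p; [set p]].
Proof.
move=> /interval_degreeP HI pI Ip0 Ip; apply/adjacent_pair; split.
- split=> //; apply/interval_degreeP => a b r; rewrite !inE.
  move=> /andP[_ aI] /andP[_ bI] ar rb; rewrite (HI a b r) // andbT.
  apply: contraTneq rb => ->; rewrite -leNgt; exact: Ip.
- by split; [exact: interval_set1 | apply/set0Pn; exists p; rewrite inE].
- by rewrite disjoint_sym disjoints1 !inE eqxx.
- move=> a b; rewrite !inE => /andP[_ aI] /eqP->.
  by rewrite /degree_order -leNgt Ip.
by rewrite setUC setD1K //; apply/interval_degreeP.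
Qed.

End DegreeOrder.

(** * Classes of cycles in the homology braid *)

Notation bcycle Delta I n := (cycle (gblock Delta I I n (n - 1))).

(** This is [hclass] with its value typed in the braid, so that the structure maps and braid maps
    apply to it directly. *)
Definition bclass (R : pzRingType) (P : finType) (C : P -> int -> lmodType R)
    (Delta : gmatrix C C) (I : {set P}) (n : int) (z : bcycle Delta I n) :
    homology_braid Delta I n :=
  hclass (gblock Delta I I (n + 1) n) z.

Section HomologyBraid.
Variables (R : pzRingType) (P : finType) (C : P -> int -> lmodType R).
Variable Delta : gmatrix C C.
Implicit Types I J : {set P}.

Lemma coord_gblock (C' : P -> int -> lmodType R) (M : gmatrix C C')
    I J m n x p :
  coord (gblock M I J m n x) p
  = if p \in I then \sum_(q in J) M p q m n (coord x q) else 0.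
Proof. exact: coord_submatrix. Qed.

Lemma bclass_surj I n (c : homology_braid Delta I n) : exists z, bclass z = c.
Proof. exact: hclass_surj. Qed.

Lemma bclass_inj I n :
  (forall u, gblock Delta I I (n + 1) n u = 0) ->
  injective (@bclass _ _ _ Delta I n).
Proof.
move=> D0 z z' /hclassP[u]; rewrite D0 => /esym/eqP; rewrite subr_eq0 => /eqP.
exact: val_inj.
Qed.

(** A row of [Delta] at an element of [J] meets only the coordinates of [z] in [J], the others being
    zero, so the restriction is again a cycle. *)
Lemma cycle_restrict I J n (z : bcycle Delta I n) :
  J \subset I -> (forall p, p \in I -> p \notin J -> coord (val z) p = 0) ->
  exists y : bcycle Delta J n, forall p, coord (val y) p = coord (val z) p.
Proof.
move=> /subsetP JI zJ; pose x := transfer (C^~ n) I J (val z).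
have xE p : coord x p = coord (val z) p.
  rewrite coord_transfer; case: ifP => // /negbT pJ.
  have [pI|pI] := boolP (p \in I); first by rewrite zJ.
  by rewrite coord_out.
suff xZ : ker_pred (gblock Delta J J n (n - 1)) x.
  by exists (Sub x xZ); rewrite SubK.
apply/eqP/coord_ext => p pJ; rewrite coord0.
have := congr1 (fun w => coord w p) (cycleE z).
rewrite coord0 => <-; rewrite !coord_gblock pJ JI // big_mkcond [RHS]big_mkcond.
apply: eq_bigr => q _; rewrite xE.
have [qJ|qJ] := boolP (q \in J); first by rewrite JI.
by case: ifP => // qI; rewrite zJ // linear0.
Qed.

Variable lt : rel P.
Hypothesis Delta_upper : upper_triangular lt Delta.

Lemma upper_triangular_block I J : adjacent lt [:: I; J] ->
  forall p q m n x, p \in J -> q \in I -> Delta p q m n x = 0.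
Proof.
move=> /adjacent_pair[_ _ dIJ ltIJ _] p q m n x pJ qI.
apply/eqP/negP => /negP /Delta_upper[epq|].
  by rewrite epq (disjointFr dIJ qI) in pJ.
by apply/negP/ltIJ.
Qed.

(** Triangularity kills the block from [I] to [J], so the inclusion is a chain map and acts on
    representatives. *)
Lemma bi_bclass I J : adjacent lt [:: I; J] ->
  forall n (z : bcycle Delta I n) (z' : bcycle Delta (I :|: J) n),
  val z' = transfer (C^~ n) I (I :|: J) (val z) ->
  bi (homology_braid Delta) I (I :|: J) n (bclass z) = bclass z'.
Proof.
move=> aIJ n z z' zz'.
have tr m l x : gblock Delta (I :|: J) (I :|: J) m l
    (transfer (C^~ m) I (I :|: J) x)
    = transfer (C^~ l) I (I :|: J) (gblock Delta I I m l x).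
  apply: submatrix_transfer => p q y pIJ qI D0; split; last by rewrite inE qI.
  apply: contraNT D0 => pI; apply/eqP/(upper_triangular_block aIJ) => //.
  by move: pIJ; rewrite inE (negPf pI).
exact: (induced_chain (hU := transfer (C^~ (n + 1)) I (I :|: J)) (tr _ _)
  (tr _ _)).
Qed.

Lemma bp_bclass I J : adjacent lt [:: I; J] ->
  forall n (z : bcycle Delta (I :|: J) n) (z' : bcycle Delta J n),
  val z' = transfer (C^~ n) (I :|: J) J (val z) ->
  bp (homology_braid Delta) (I :|: J) J n (bclass z) = bclass z'.
Proof.
move=> aIJ n z z' zz'.
have tr m l x : gblock Delta J J m l (transfer (C^~ m) (I :|: J) J x)
    = transfer (C^~ l) (I :|: J) J (gblock Delta (I :|: J) (I :|: J) m l x).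
  apply: submatrix_transfer => p q y pJ qIJ D0.
  split; first by rewrite inE pJ orbT.
  apply: contraNT D0 => qJ; apply/eqP/(upper_triangular_block aIJ) => //.
  by move: qIJ; rewrite inE (negPf qJ) orbF.
exact: (induced_chain (hU := transfer (C^~ (n + 1)) (I :|: J) J) (tr _ _)
  (tr _ _)).
Qed.

End HomologyBraid.

(** * Modules in one degree: homology of a single element *)

Definition concentrated (R : pzRingType) (P : finType)
    (C : P -> int -> lmodType R) (k : P -> int) : Prop :=
  forall p n, n <> k p -> forall x : C p n, x = 0.

Section ConcentratedBoundary.
Variables (R : pzRingType) (P : finType) (C : P -> int -> lmodType R).
Variables (k : P -> int) (Delta : gmatrix C C).
Hypothesis hC : concentrated C k.
Hypothesis Delta_deg : homogeneous (-1) Delta.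

Lemma boundary_entry p q m n x :
  Delta p q m n x != 0 -> [/\ m = k q, n = k p & n = m - 1].
Proof.
move=> D0; split; last exact: Delta_deg D0.
  by apply/eqP; apply: contraNT D0 => /eqP mq; rewrite (hC mq x) linear0.
by apply/eqP; apply: contraNT D0 => /eqP np; apply/eqP/hC.
Qed.

(** A nonzero value would give [k p = k p - 1]. Hence over {p} every chain is a cycle and every
    boundary is zero. *)
Lemma boundary_set1 p m n x : gblock Delta [set p] [set p] m n x = 0.
Proof.
apply: coord_ext => q qp; rewrite coord_gblock qp coord0 big_set1; apply/eqP.
apply: contraT => /boundary_entry[mp nq].
by move: qp nq mp; rewrite inE => /eqP-> -> ->; lia.
Qed.

Lemma coord_deg (I : {set P}) n (x : isum (C^~ n) I) p :
  k p <> n -> coord x p = 0.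
Proof. by move=> kpn; apply: hC => e; apply: kpn. Qed.

Lemma cycle_set1 p n (u : C p n) :
  exists z : bcycle Delta [set p] n, coord (val z) p = u.
Proof.
have [x [xp _]] := isum_single (E := C^~ n) u (set11 p).
have xZ : ker_pred (gblock Delta [set p] [set p] n (n - 1)) x.
  by apply/eqP/boundary_set1.
by exists (Sub x xZ); rewrite SubK.
Qed.

(** The differentials at {p} and {q} vanish, so the block preserves cycles and boundaries trivially,
    and the connecting map is the entry Delta(p,q) itself. *)
Lemma bd_bclass p q m
    (z : bcycle Delta [set q] m) (z' : bcycle Delta [set p] (m - 1)) :
  coord (val z') p = Delta p q m (m - 1) (coord (val z) q) ->
  bd (homology_braid Delta) [set q] [set p] m (bclass z) = bclass z'.
Proof.
move=> zz'; apply: induced_hclass => [x _|u _|].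
- exact: boundary_set1.
- by exists 0; rewrite linear0 boundary_set1 linear0.
- apply: coord_ext => a; rewrite inE => /eqP ->.
  by rewrite zz' coord_gblock set11 big_set1.
Qed.

Lemma homology_set1 p n :
  exists cls : {linear C p n -> homology_braid Delta [set p] n},
    bijective cls
    /\ forall z : bcycle Delta [set p] n, bclass z = cls (coord (val z) p).
Proof.
pose ev (z : bcycle Delta [set p] n) := coord (val z) p.
have ev_lin : linear ev by move=> a z z'; rewrite /ev linearP coord_linear.
pose evI := GRing.isLinear.Build R _ (C p n) _ ev ev_lin.
pose Ev : {linear bcycle Delta [set p] n -> C p n} := HB.pack ev evI.
have ev_inj : injective ev.
  move=> z z' zz'; apply/val_inj/coord_ext => q.
  by rewrite inE => /eqP ->.
have ev_surj u : exists z, ev z = u := cycle_set1 u.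
have [h hE] := linear_lift (f := Ev) idfun (inj_surj_bij ev_inj ev_surj).
have evK z : h (ev z) = z by apply: ev_inj; exact: hE.
pose cls : {linear C p n -> homology_braid Delta [set p] n} :=
  @hclass _ _ _ _ (gblock Delta [set p] [set p] (n + 1) n)
    (gblock Delta [set p] [set p] n (n - 1)) \o h.
have clsE z : bclass z = cls (ev z) by rewrite /= evK.
exists cls; split=> //; apply: inj_surj_bij => [u v|c].
  have [y <-] := ev_surj u; have [z <-] := ev_surj v.
  by rewrite -!clsE => /(bclass_inj (boundary_set1 _))->.
by have [z <-] := bclass_surj c; exists (ev z).
Qed.

End ConcentratedBoundary.

(** * Diagonal matrices *)

Section DiagonalMatrix.
Variables (R : pzRingType) (P : finType) (C C' : P -> int -> lmodType R).
Variable t : forall p n, {linear C p n -> C' p n}.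

(** The type of an entry depends on its indices, so [t q m] is transported along the decided
    equalities of elements and degrees. *)
Definition diagonal_matrix : gmatrix C C' := fun p q m n =>
  match q =P p, m =P n with
  | ReflectT qp, ReflectT mn =>
      match qp in _ = p', mn in _ = n' return {linear C q m -> C' p' n'} with
      | erefl, erefl => t q m
      end
  | _, _ => \0
  end.

Lemma diagonal_matrix_diag p n x : diagonal_matrix p p n n x = t p n x.
Proof.
rewrite /diagonal_matrix; case: eqP => // pp; case: eqP => // nn.
by rewrite (eq_irrelevance pp erefl) (eq_irrelevance nn erefl).
Qed.

Lemma diagonal_matrix_entry p q m n x :
  diagonal_matrix p q m n x != 0 -> p = q /\ m = n.
Proof.
rewrite /diagonal_matrix; case: eqP => qp; last by rewrite eqxx.
by case: eqP => mn; last by rewrite eqxx.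
Qed.

Lemma coord_diagonal (I : {set P}) n x p :
  coord (gblock diagonal_matrix I I n n x) p = t p n (coord x p).
Proof.
rewrite coord_gblock; case: ifP => [pI|/negbT pI]; last first.
  by rewrite coord_out ?linear0.
rewrite (bigD1 p) //= diagonal_matrix_diag big1 ?addr0 // => q /andP[_ qp].
by apply/eqP; apply: contraNT qp => /diagonal_matrix_entry[->].
Qed.

Lemma diagonal_transfer (I K : {set P}) n x :
  gblock diagonal_matrix K K n n (transfer (C^~ n) I K x)
  = transfer (C'^~ n) I K (gblock diagonal_matrix I I n n x).
Proof.
apply: coord_ext => p pK.
by rewrite coord_diagonal !coord_transfer pK coord_diagonal.
Qed.

Lemma diagonal_chain (Delta : gmatrix C C) (Delta' : gmatrix C' C') :
  (forall p q m n x,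
     Delta' p q m n (t q m x) = t p n (Delta p q m n x)) ->
  forall (I : {set P}) m n x,
    gblock Delta' I I m n (gblock diagonal_matrix I I m m x)
    = gblock diagonal_matrix I I n n (gblock Delta I I m n x).
Proof.
move=> tD I m n x; apply: coord_ext => p pI.
rewrite coord_diagonal !coord_gblock pI linear_sum.
by under eq_bigr do rewrite coord_diagonal tD.
Qed.

End DiagonalMatrix.

(** * Composition and lifting of braid maps *)

Section BraidMaps.
Variables (R : pzRingType) (P : finType) (lt : rel P).

Lemma braid_map_comp (A B G : braid_data R P) (f : braid_fam A B)
    (g : braid_fam B G) :
  braid_map lt f -> braid_map lt g -> braid_map lt (fun I n => g I n \o f I n).
Proof.
move=> [fi fp fd] [gi gp gd]; split=> I J aIJ n x /=.
- by rewrite fi // gi.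
- by rewrite fp // gp.
- by rewrite fd // gd.
Qed.

Lemma braid_map_lift (A B G : braid_data R P) (f : braid_fam A G)
    (g : braid_fam B G) :
  braid_map lt f -> braid_iso lt g ->
  exists psi : braid_fam A B,
    braid_map lt psi
    /\ forall I, interval lt I -> forall n c, g I n (psi I n c) = f I n c.
Proof.
move=> [fi fp fd] [[gi gp gd] g_bij].
have lift I n : exists h : {linear A I n -> B I n},
    interval lt I -> forall c, g I n (h c) = f I n c.
  (* Bijectivity is given on intervals only; elsewhere the lift is set to 0. *)
  have [/g_bij/(_ n) gIn|nI] := boolP (interval lt I); last by exists \0.
  by have [h hE] := linear_lift (f I n) gIn; exists h.
pose psi I n := sval (cid (lift I n)).
have psiE I : interval lt I -> forall n c, g I n (psi I n c) = f I n c.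
  by move=> HI n; rewrite /psi; case: (cid (lift I n)) => h /= /(_ HI).
exists psi; split=> //; split=> I J aIJ n x.
all: have /adjacent_pair[[HI _] [HJ _] _ _ HIJ] := aIJ.
- by apply: (bij_inj (g_bij _ HIJ n)); rewrite psiE // gi // psiE // fi.
- by apply: (bij_inj (g_bij _ HJ n)); rewrite psiE // gp // psiE // fp.
- by apply: (bij_inj (g_bij _ HI (n - 1))); rewrite psiE // gd // psiE // fd.
Qed.

End BraidMaps.

(** * A map of homology braids is diagonal *)

Section MapsOfHomologyBraids.
Variables (R : pzRingType) (P : finType) (C C' : P -> int -> lmodType R).
Variables (k : P -> int) (Delta : gmatrix C C) (Delta' : gmatrix C' C').
Let lt := degree_order k.
Hypotheses (hC : concentrated C k) (hC' : concentrated C' k).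
Hypotheses (Delta_deg : homogeneous (-1) Delta).
Hypotheses (Delta_deg' : homogeneous (-1) Delta').
Hypotheses (Delta_up : upper_triangular lt Delta).
Hypotheses (Delta_up' : upper_triangular lt Delta').
Variable psi : braid_fam (homology_braid Delta) (homology_braid Delta').
Hypothesis psi_map : braid_map lt psi.

(** The map [t p n] is [psi] at {p} read through the identification of H({p}) with C(p). The
    equivalence allows passing from classes to coordinates and back. *)
Lemma braid_map_diagonal : exists t : forall p n, {linear C p n -> C' p n},
  forall p n (z : bcycle Delta [set p] n) (z' : bcycle Delta' [set p] n),
  psi [set p] n (bclass z) = bclass z'
  <-> coord (val z') p = t p n (coord (val z) p).
Proof.
suff tP p n : exists t : {linear C p n -> C' p n},
    forall (z : bcycle Delta [set p] n) (z' : bcycle Delta' [set p] n),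
    psi [set p] n (bclass z) = bclass z'
    <-> coord (val z') p = t (coord (val z) p).
  by exists (fun p n => sval (cid (tP p n))) => p n; case: cid.
have [cls [cls_bij clsE]] := homology_set1 hC Delta_deg p n.
have [cls' [cls_bij' clsE']] := homology_set1 hC' Delta_deg' p n.
have [t tE] := linear_lift (psi [set p] n \o cls) cls_bij'.
exists t => z z'; rewrite clsE clsE'; split=> [e|->].
  by apply: (bij_inj cls_bij'); rewrite tE -e.
exact/esym/tE.
Qed.

Variable t : forall p n, {linear C p n -> C' p n}.
Hypothesis tP :
  forall p n (z : bcycle Delta [set p] n) (z' : bcycle Delta' [set p] n),
  psi [set p] n (bclass z) = bclass z'
  <-> coord (val z') p = t p n (coord (val z) p).

Lemma diagonal_commutes p q m n x :
  Delta' p q m n (t q m x) = t p n (Delta p q m n x).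
Proof.
(* Outside these degrees both entries vanish; within them [k q = k p + 1], and compatibility with
   the connecting map of ({p},{q}) applies. *)
have [/and3P[/eqP mq /eqP np /eqP nm]|nE] :=
  boolP [&& m == k q, n == k p & n == m - 1]; last first.
  have D0 y : Delta p q m n y = 0.
    apply/eqP; apply: contraNT nE => /(boundary_entry hC Delta_deg)[-> -> ->].
    by rewrite !eqxx.
  have D0' y : Delta' p q m n y = 0.
    apply/eqP; apply: contraNT nE.
    by move=> /(boundary_entry hC' Delta_deg')[-> -> ->]; rewrite !eqxx.
  by rewrite D0 D0' linear0.
have {np}kp : k p = m - 1 by rewrite -np.
subst n; have aqp : adjacent lt [:: [set p]; [set q]].
  by apply: adjacent_set1; [apply: contra_eq_neq kp => ->|]; lia.
have [z zx] := cycle_set1 hC Delta_deg x.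
have [w wx] := cycle_set1 hC Delta_deg (Delta p q m (m - 1) x).
have [z' zx'] := cycle_set1 hC' Delta_deg' (t q m x).
have [w' wx'] :=
  cycle_set1 hC' Delta_deg' (Delta' p q m (m - 1) (t q m x)).
have zw := bd_bclass hC Delta_deg (z := z) (z' := w).
have zw' := bd_bclass hC' Delta_deg' (z := z') (z' := w').
have := braid_map_d psi_map aqp (bclass z).
rewrite zw ?zx //; have /tP -> : coord (val z') q = t q m (coord (val z) q).
  by rewrite zx zx'.
by rewrite zw' ?zx' // => /tP; rewrite wx wx'.
Qed.

(** Any [p] in [I] of degree [n] is maximal, so compatibility with the projection to {p} identifies
    the coordinate at [p] of a representative of the image; coordinates of other degrees are
    zero. *)
Lemma braid_map_class_top (I : {set P}) n
    (z : bcycle Delta I n) (z' : bcycle Delta' I n) :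
  interval lt I -> (forall p, p \in I -> k p <= n) ->
  (forall p, coord (val z') p = t p n (coord (val z) p)) ->
  psi I n (bclass z) = bclass z'.
Proof.
(* The representatives themselves are shown equal, as they must be: [I] has no chains of degree n +
   1, hence no boundaries of degree n. *)
move=> HI In zz'; have [y yE] := bclass_surj (psi I n (bclass z)).
rewrite -yE; congr bclass; apply/val_inj/coord_ext => p pI.
have [kpn|/eqP kpn] := eqVneq (k p) n; last by rewrite !(coord_deg hC').
rewrite zz'.
have [Ip0|Ip] := eqVneq (I :\ p) set0.
  have eI : I = [set p] by rewrite -(setD1K pI) Ip0 setU0.
  by subst I; apply/tP.
have aIp : adjacent lt [:: I :\ p; [set p]].
  by apply: adjacent_degree_top => // q qI; rewrite kpn In.
have eI : I = I :\ p :|: [set p] by rewrite setUC setD1K.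
(* Generalizing [I :\ p] lets [I] be replaced by the union that indexes the structure maps. *)
move: (I :\ p) aIp eI => K aKp eI; subst I.
have [u uE] := cycle_set1 hC Delta_deg (coord (val z) p).
have [v vE] := cycle_set1 hC' Delta_deg' (coord (val y) p).
have zu : bp (homology_braid Delta) (K :|: [set p]) [set p] n (bclass z)
    = bclass u.
  apply: (bp_bclass Delta_up aKp); apply: coord_ext => q.
  by rewrite coord_transfer inE => /eqP ->; rewrite eqxx.
have yv : bp (homology_braid Delta') (K :|: [set p]) [set p] n (bclass y)
    = bclass v.
  apply: (bp_bclass Delta_up' aKp); apply: coord_ext => q.
  by rewrite coord_transfer inE => /eqP ->; rewrite eqxx.
have := braid_map_p psi_map aKp (bclass z).
by rewrite -yE zu yv => /tP; rewrite uE vE.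
Qed.

(* A cycle of degree n in I is supported in degree n, hence comes from the   *)
(* part of I of degree at most n.                                            *)
Lemma braid_map_class (I : {set P}) n
    (z : bcycle Delta I n) (z' : bcycle Delta' I n) :
  interval lt I ->
  (forall p, coord (val z') p = t p n (coord (val z) p)) ->
  psi I n (bclass z) = bclass z'.
Proof.
move=> HI zz'; pose A := [set p in I | k p <= n].
pose B := [set p in I | n < k p].
(* [adjacent] demands nonempty pieces. If [B] is empty the previous lemma applies to [I]; if [A] is
   empty, [I] has nothing in degree [n] and both cycles are zero. *)
have [B0|B1] := eqVneq B set0.
  apply: braid_map_class_top => // p pI; rewrite leNgt; apply/negP => np.
  by have := in_set0 p; rewrite -B0 inE pI np.
have [A0|A1] := eqVneq A set0.
  have kI p : p \in I -> k p <> n.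
    by move=> pI kpn; have := in_set0 p; rewrite -A0 inE pI kpn lexx.
  have -> : z = 0.
    apply/val_inj/coord_ext => p pI; rewrite linear0 coord0.
    exact: (coord_deg hC _ (kI p pI)).
  have -> : z' = 0.
    apply/val_inj/coord_ext => p pI; rewrite linear0 coord0.
    exact: (coord_deg hC' _ (kI p pI)).
  by rewrite /bclass !linear0.
have aAB : adjacent lt [:: A; B] by exact: adjacent_degree_cut.
have HA : interval lt A by have /adjacent_pair[[]] := aAB.
have An p : p \in A -> k p <= n by rewrite inE => /andP[].
have AI : A \subset I by apply/subsetP => p; rewrite inE => /andP[].
have kA p : p \in I -> p \notin A -> k p <> n.
  by move=> pI; rewrite inE pI => /= + kpn; rewrite kpn lexx.
have [y yz] := cycle_restrict (z := z) AI
  (fun p pI pA => coord_deg hC (val z) (kA p pI pA)).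
have [y' yz'] := cycle_restrict (z := z') AI
  (fun p pI pA => coord_deg hC' (val z') (kA p pI pA)).
have yy' : psi A n (bclass y) = bclass y'.
  by apply: braid_map_class_top => // p; rewrite yz yz'.
have eI : I = A :|: B.
  by apply/setP => p; rewrite !inE; case: (p \in I) => //=; lia.
move: (A) (B) aAB eI y y' yz yz' yy' {B1 A1 HA An AI kA}.
move=> K L aKL eI y y' yz yz' yy'; subst I.
have iy : bi (homology_braid Delta) K (K :|: L) n (bclass y) = bclass z.
  apply: (bi_bclass Delta_up aKL); apply: coord_ext => p pKL.
  by rewrite coord_transfer pKL.
have iy' : bi (homology_braid Delta') K (K :|: L) n (bclass y') = bclass z'.
  apply: (bi_bclass Delta_up' aKL); apply: coord_ext => p pKL.
  by rewrite coord_transfer pKL.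
by rewrite -iy -iy' -yy' (braid_map_i psi_map aKL).
Qed.

End MapsOfHomologyBraids.

(** * Action of a chain matrix on classes *)

Section ChainMatrix.
Variables (R : pzRingType) (P : finType) (C C' : P -> int -> lmodType R).
Variables (Delta : gmatrix C C) (Delta' : gmatrix C' C') (T : gmatrix C C').
Variable I : {set P}.
Hypothesis T_chain : forall m n x,
  gblock Delta' I I m n (gblock T I I m m x)
  = gblock T I I n n (gblock Delta I I m n x).

Lemma homology_map_bclass n (z : bcycle Delta I n) (z' : bcycle Delta' I n) :
  val z' = gblock T I I n n (val z) ->
  homology_map Delta Delta' T I n (bclass z) = bclass z'.
Proof.
by apply: (induced_chain (hU := gblock T I I _ _)) => u; exact: T_chain.
Qed.

Lemma chain_cycle n (z : bcycle Delta I n) :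
  exists z' : bcycle Delta' I n, val z' = gblock T I I n n (val z).
Proof.
have zZ : ker_pred (gblock Delta' I I n (n - 1)) (gblock T I I n n (val z)).
  by apply/eqP; rewrite T_chain cycleE linear0.
by exists (Sub _ zZ); rewrite SubK.
Qed.

End ChainMatrix.

(** * Existence and uniqueness of the transition matrix *)

Theorem theorem3p3 (R : pzRingType) (P : finType)
    (C C' : P -> int -> lmodType R) (k : P -> int)
    (hC : forall p n, n <> k p -> forall x : C p n, x = 0)
    (hC' : forall p n, n <> k p -> forall x : C' p n, x = 0)
    (G G' : braid_data R P)
    (hG : graded_module_braid (degree_order k) G)
    (hG' : graded_module_braid (degree_order k) G')
    (Delta : gmatrix C C) (Delta' : gmatrix C' C')
    (hDelta : connection_matrix (degree_order k) Delta G)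
    (hDelta' : connection_matrix (degree_order k) Delta' G')
    (Phi : braid_fam (homology_braid Delta) G)
    (hPhi : braid_iso (degree_order k) Phi)
    (Phi' : braid_fam (homology_braid Delta') G')
    (hPhi' : braid_iso (degree_order k) Phi')
    (theta : braid_fam G G')
    (htheta : braid_iso (degree_order k) theta) :
  exists T : gmatrix C C',
    transition_matrix (degree_order k) Phi Phi' theta T
    /\ forall T' : gmatrix C C',
         transition_matrix (degree_order k) Phi Phi' theta T' ->
         forall p q m n x, T' p q m n x = T p q m n x.
Proof.
have [[Ddeg _] Dup _ _] := hDelta; have [[Ddeg' _] Dup' _ _] := hDelta'.
have [psi [psi_map psiE]] :=
  braid_map_lift (braid_map_comp (proj1 hPhi) (proj1 htheta)) hPhi'.
have [t tP] := braid_map_diagonal hC hC' Ddeg Ddeg' psi.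
have tD := diagonal_commutes hC hC' Ddeg Ddeg' psi_map tP.
have chainT := diagonal_chain tD.
exists (diagonal_matrix t); split.
  split=> [p q m n x||||].
  - by move=> /diagonal_matrix_entry[_ ->]; rewrite addr0.
  - by move=> I _; exact: chainT.
  - by move=> I J _ n x; exact: diagonal_transfer.
  - by move=> I J _ n x; exact: diagonal_transfer.
  move=> I HI n c; have [z <-] := bclass_surj c.
  have [z' zz'] := chain_cycle (chainT I) z.
  rewrite (homology_map_bclass (chainT I) zz') -[RHS](psiE I HI).
  congr (Phi' I n _); apply/esym.
  apply: (braid_map_class hC hC' Ddeg Ddeg' Dup Dup' psi_map tP HI) => p.
  by rewrite zz' coord_diagonal.
move=> T' [Tdeg Tchain Ti _ Tcov] p q m n x.
have [->|nm] := eqVneq n m; last first.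
  have nm0 : n <> m + 0 by apply/eqP; rewrite addr0.
  have -> : T' p q m n x = 0 by apply/eqP; apply: contraT => /Tdeg /nm0.
  apply/esym/eqP; apply: contraT => /diagonal_matrix_entry[_ mn].
  by rewrite mn eqxx in nm.
(* Off degree [k p] the target is zero, off degree [k q] the source; only [k p = k q = m]
   remains. *)
have [kp|/eqP kp] := eqVneq m (k p); last first.
  by rewrite (hC' _ _ kp (T' _ _ _ _ _)) [RHS](hC' _ _ kp).
have [kq|/eqP kq] := eqVneq m (k q); last by rewrite (hC _ _ kq x) !linear0.
have [epq|pq] := eqVneq p q.
  (* Covering at {p} and injectivity of [Phi'] give the action of [T'] on H({p}), that is, its entry
     on C(p). *)
  subst q; rewrite diagonal_matrix_diag.
  have [z zx] := cycle_set1 hC Ddeg x.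
  have Hp := interval_set1 k p.
  have [z' zz'] := chain_cycle (Tchain _ Hp) z.
  have := Tcov _ Hp m (bclass z).
  rewrite (homology_map_bclass (Tchain _ Hp) zz') -[RHS](psiE _ Hp).
  move/(bij_inj (proj2 hPhi' _ Hp m))/esym/tP.
  by rewrite zz' zx coord_gblock set11 big_set1 zx.
have aqp : adjacent (degree_order k) [:: [set q]; [set p]].
  by apply: adjacent_set1; [rewrite eq_sym | rewrite -kp -kq; lia].
have [y [yx _]] := isum_single (E := C^~ m) x (set11 q).
(* [y] is [x] placed at [q]. At [p], one side of the compatibility with the inclusion is the entry
   of [T'] applied to [x]; the other is 0, as [p] lies outside {q}. *)
have := congr1 (fun w => coord w p) (Ti _ _ aqp m y).
rewrite coord_gblock coord_transfer !inE eqxx orbT.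
rewrite (coord_out (I := [set q])) ?inE // (bigD1 q) ?inE ?eqxx //=.
rewrite coord_transfer !inE eqxx yx big1 ?addr0 => [->|a].
  by apply/esym/eqP; apply: contraNT pq => /diagonal_matrix_entry[-> _].
rewrite coord_transfer => /andP[_ aq].
by rewrite (coord_out y) ?inE // if_same linear0.
Qed.
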